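(* Let $X$ be a Banach space such that $C([0,1]^d)\subset X$ is continuously embedded in $X$, with embedding constant $c_0$ (that is, $\|f\|_X\le c_0\|f\|_{C([0,1]^d)}$ for all $f\in C([0,1]^d)$). Let $\sigma$ be an $L$-Lipschitz sigmoidal function or $\sigma=\mathrm{ReLU}$ (in which case $L=1$), and suppose that $w(n)\ge 1$ and $LWw(n)\geq 2$ for all $n\ge 1$. Then there are constants $c_1,c_2>0$, depending only on $c_0,d,L,W$, such that for every $n\geq 1$ the mapping $\Phi_\sigma:(B_{\ell_\infty^{\tilde n}}(w(n)),\|\cdot\|_{\ell_\infty^{\tilde n}})\to X$ is $L_n$-Lipschitz, namely $$\|\Phi_\sigma(y)-\Phi_\sigma(y')\|_X\leq c_0\|\Phi_\sigma(y)-\Phi_\sigma(y')\|_{C([0,1]^d)}\leq L_n\|y-y'\|_{\ell_\infty^{\tilde n}},\quad y,y'\in B_{\ell_\infty^{\tilde n}}(w(n)),$$ with a constant $L_n$ satisfying $$2^{c_1n(1+\log_2w(n))}< L_n<2^{c_2n(1+\log_2w(n))}.$$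
   Context: Deep neural networks. Fix an input dimension $d\ge1$, a width $W\geq 2$, and an activation function $\sigma:\mathbb R\to\mathbb R$ which is either $\mathrm{ReLU}(t)=\max\{0,t\}$ (then $L:=1$), or an $L$-Lipschitz sigmoidal function; the only properties of the latter that are used are $|\sigma(t)|\le 1$ and $|\sigma(t_1)-\sigma(t_2)|\le L|t_1-t_2|$ for all $t,t_1,t_2\in\mathbb R$. Let $\bar\sigma:\mathbb R^W\to\mathbb R^W$ be $\sigma$ applied coordinatewise. For depth $n\ge1$ consider affine mappings $A^{(0)}:\mathbb R^d\to\mathbb R^W$, $A^{(\ell)}:\mathbb R^W\to\mathbb R^W$ ($\ell=1,\dots,n-1$), $A^{(n)}:\mathbb R^W\to\mathbb R$. Let $y\in\mathbb R^{\tilde n}$ be the vector listing, in a fixed order, all entries of the matrices and offset vectors (biases) of these affine mappings, where $\tilde n=W(d+1)+(n-1)W(W+1)+W+1$ is the total number of such entries. Define the function on $[0,1]^d$ $$\Phi_\sigma(y):=A^{(n)}\circ\bar\sigma\circ A^{(n-1)}\circ\cdots\circ\bar\sigma\circ A^{(0)}.$$ For $r>0$, $B_{\ell_\infty^{m}}(r):=\{y\in\mathbb R^m:\|y\|_{\ell_\infty^m}\le r\}$, where $\|y\|_{\ell_\infty^m}=\max_j|y_j|$. The function $w:\mathbb N\to[1,\infty)$ is a given bound on the parameters. *)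

(* Defs.v *)
From HB Require Import structures.
From mathcomp Require Import all_boot all_order all_algebra.
From mathcomp Require Import all_classical all_reals all_analysis.

Set Implicit Arguments.
Unset Strict Implicit.
Unset Printing Implicit Defensive.

Import Order.TTheory GRing.Theory Num.Theory.
Import numFieldNormedType.Exports.

Local Open Scope classical_set_scope.
Local Open Scope ring_scope.

Definition cube (R : realType) (d : nat) : set 'rV[R]_d :=
  [set x | forall i, 0 <= x ord0 i <= 1].

Definition cube_cont (R : realType) (d : nat) :
    {pred set_type (@cube R d) -> R} :=
  mem [set f : set_type (@cube R d) -> R | continuous f].

(* C([0,1]^d): the functions live on the subtype of points of the cube, with the
   topology induced from 'rV[R]_d, so that equality is pointwise equality on the
   cube. It is normed by the sup norm, see cubeC_normE. *)
Record cubeC (R : realType) (d : nat) := CubeC {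
  cubeC_fun :> set_type (@cube R d) -> R;
  cubeC_contP : cubeC_fun \in @cube_cont R d }.

HB.instance Definition _ (R : realType) (d : nat) :=
  [isSub for @cubeC_fun R d].
HB.instance Definition _ (R : realType) (d : nat) :=
  [Choice of @cubeC R d by <:].

Section continuous_real_functions.
Context (R : realType) (T : topologicalType).

Lemma continuous_lincomb (a : R) (f g : T -> R) :
  continuous f -> continuous g -> continuous (fun x => a * f x + g x).
Proof.
move=> cf cg x; apply: cvgD; last exact: cg.
by apply: cvgMl_tmp; exact: cf.
Qed.

Lemma continuous_wsum (p : nat) (a : 'I_p -> R) (b : R) (g : 'I_p -> T -> R) :
  (forall j, continuous (g j)) ->
  continuous (fun x => \sum_j g j x * a j + b).
Proof.
move=> cg x; apply: cvgD; last exact: cvg_cst.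
apply: cvg_big => [|j _]; [exact: add_continuous|].
by apply: cvgMr_tmp; exact: cg.
Qed.

Lemma continuous_normr (f : T -> R) :
  continuous f -> continuous (fun x => `|f x|).
Proof. by move=> cf x; apply: cvg_norm; exact: cf. Qed.

Lemma continuous_post (f : T -> R) (s : R -> R) :
  continuous f -> continuous s -> continuous (fun x => s (f x)).
Proof.
by move=> cf cs x; apply: (@continuous_comp _ _ _ f s); [exact: cf|exact: cs].
Qed.

End continuous_real_functions.

Section cube_continuous_functions.
Context (R : realType) (d : nat).
Local Notation Q := (set_type (@cube R d)).
Local Notation C := (@cubeC R d).

Lemma cubeC_continuous (f : C) : continuous f.
Proof. by case: f => f /= /set_mem. Qed.

Lemma cube_cont_submod_closed : submod_closed (@cube_cont R d).
Proof.
split.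
  by apply/mem_set => x; exact: (@cst_continuous _ R).
move=> a f g /set_mem cf /set_mem cg; apply/mem_set.
exact: (@continuous_lincomb R Q a f g cf cg).
Qed.

HB.instance Definition _ := GRing.isSubmodClosed.Build _ _ (@cube_cont R d)
  cube_cont_submod_closed.
HB.instance Definition _ := [SubChoice_isSubLmodule of C by <:].

Definition cubeC_norm (f : C) : R := sup (range (fun x : Q => `|f x|)).

Lemma cube0 : @cube R d 0.
Proof. by move=> i; rewrite mxE lexx ler01. Qed.

Let cube_origin : Q := exist _ 0 (mem_set cube0).

Lemma cubeC_has_sup (f : C) : has_sup (range (fun x : Q => `|f x|)).
Proof.
split; first by exists `|f cube_origin|, cube_origin.
have cQ : compact (@cube R d).
  have -> : @cube R d = [set v : 'rV[R]_d | forall i,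
      [set` `[0, 1]%R] (v ord0 i)].
    by apply/seteqP; split => x /= h i; have := h i; rewrite in_itv.
  apply: (@rV_compact R d (fun=> [set` `[0, 1]%R])) => i.
  exact: segment_compact.
have cf : {within @cube R d, continuous (valL_ 0 (fun x : Q => `|f x|))}.
  apply/subspace_valL_continuousP'.
  exact: continuous_normr (@cubeC_continuous f).
have [c _ cmax] := compact_EVT_max (ex_intro _ _ cube0) cQ cf.
exists (valL_ 0 (fun x : Q => `|f x|) c) => _ [x _ <-].
have := cmax _ (valP x).
have /(congr1 (fun g => g x)) :=
  @valLK _ _ (0 : R) (@cube R d) (fun x : Q => `|f x|).
by rewrite /sigL /= => ->.
Qed.

Lemma cubeC_norm_ge (f : C) x : `|f x| <= cubeC_norm f.
Proof. by apply: ub_le_sup; [exact: (cubeC_has_sup f).2|exists x]. Qed.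

Lemma cubeC_norm_le (f : C) (M : R) :
  (forall x, `|f x| <= M) -> cubeC_norm f <= M.
Proof.
by move=> h; apply: ge_sup; [exact: (cubeC_has_sup f).1|move=> _ [x _ <-]].
Qed.

Lemma cubeC_normD (f g : C) : cubeC_norm (f + g) <= cubeC_norm f + cubeC_norm g.
Proof.
apply: cubeC_norm_le => x; apply: (le_trans (ler_normD _ _)).
by apply: lerD; exact: cubeC_norm_ge.
Qed.

Lemma cubeC_normZ (a : R) (f : C) : cubeC_norm (a *: f) = `|a| * cubeC_norm f.
Proof.
have H b (g : C) : cubeC_norm (b *: g) <= `|b| * cubeC_norm g.
  apply: cubeC_norm_le => x; rewrite [X in `|X|]/= normrM.
  by apply: ler_wpM2l => //; exact: cubeC_norm_ge.
apply/eqP; rewrite eq_le H /=.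
have [->|a0] := eqVneq a 0.
    rewrite normr0 mul0r.
  exact: le_trans (normr_ge0 _) (cubeC_norm_ge _ cube_origin).
rewrite -ler_pdivlMl ?normr_gt0// -normfV.
by apply: le_trans (H _ _); rewrite scalerA mulVf// scale1r.
Qed.

Lemma cubeC_norm0_eq0 (f : C) : cubeC_norm f = 0 -> f = 0.
Proof.
move=> f0; apply: val_inj; apply/funext => x /=.
by apply/eqP; rewrite -normr_le0 -f0; exact: cubeC_norm_ge.
Qed.

HB.instance Definition _ := Lmodule_isNormed.Build R C
  cubeC_normD cubeC_normZ cubeC_norm0_eq0.

Lemma cubeC_normE (f : C) : `|f| = sup (range (fun x : Q => `|f x|)).
Proof. by []. Qed.

End cube_continuous_functions.

Definition relu (R : realType) (t : R) : R := Num.max 0 t.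

(* No limits at +-oo are required: boundedness by 1 and the Lipschitz bound are
   the only properties of a sigmoidal function that enter. *)
Definition lipschitz_sigmoidal (R : realType) (L : R) (sigma : R -> R) : Prop :=
  (forall t, `|sigma t| <= 1) /\
  (forall t1 t2, `|sigma t1 - sigma t2| <= L * `|t1 - t2|).

Definition activation (R : realType) (L : R) (sigma : R -> R) : Prop :=
  (sigma = @relu R /\ L = 1) \/ lipschitz_sigmoidal L sigma.

Definition nparams (d W n : nat) : nat :=
  (W * (d + 1) + (n - 1) * (W * (W + 1)) + W + 1)%N.

(* k-th entry of the parameter vector; the indices used below stay below m. *)
Definition param (R : realType) (m : nat) (y : 'rV[R]_m) (k : nat) : R :=
  oapp (y ord0) 0 (insub k).

(* The affine map 'rV_p -> 'rV_q stored from position off on: for each of the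
   q output coordinates, a block made of its p matrix entries followed by its
   bias. Vectors are rows, so the matrix acts on the right. *)
Definition affine (R : realType) (m : nat) (y : 'rV[R]_m) (off p q : nat)
    (x : 'rV[R]_p) : 'rV[R]_q :=
  x *m (\matrix_(j < p, i < q) param y (off + i * (p + 1) + j))
    + \row_(i < q) param y (off + i * (p + 1) + p).

(* Position in y of the first parameter of A^(l), for l >= 1. *)
Definition offset (d W l : nat) : nat :=
  (W * (d + 1) + (l - 1) * (W * (W + 1)))%N.

(* hidden l = sigma o A^(l) o ... o sigma o A^(0) *)
Fixpoint hidden (R : realType) (d W m : nat) (sigma : R -> R) (y : 'rV[R]_m)
    (l : nat) (x : 'rV[R]_d) : 'rV[R]_W :=
  map_mx sigma
    (if l is l'.+1
     then affine y (offset d W l) W (hidden W sigma y l' x)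
     else affine y 0 W x).

Definition network (R : realType) (d W n : nat) (sigma : R -> R)
    (y : 'rV[R]_(nparams d W n)) (x : 'rV[R]_d) : R :=
  affine y (offset d W n) 1 (hidden W sigma y (n - 1) x) ord0 ord0.

Section network_continuity.
Context (R : realType) (d W : nat).
Local Notation Q := (set_type (@cube R d)).

Lemma activation_continuous (L : R) (sigma : R -> R) :
  activation L sigma -> continuous sigma.
Proof.
move=> hs.
have {hs}[K K0 hK] : exists2 K : R, 0 < K &
    forall t1 t2, `|sigma t1 - sigma t2| <= K * `|t1 - t2|.
  case: hs => [[-> _]|[_ hL]].
    exists 1 => // s t; rewrite mul1r /relu.
    wlog st : s t / s <= t => [hw|].
      by have [|/ltW] := leP s t => /hw//; rewrite distrC (distrC t).
    rewrite !(distrC _ t) !(distrC _ (Num.max 0 t)).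
    rewrite (ger0_norm (x := t - s)) ?subr_ge0//.
    rewrite ger0_norm ?subr_ge0 ?ge_max ?le_max ?lexx ?st ?orbT//.
    rewrite lerBlDr ge_max; apply/andP; split.
      by rewrite addr_ge0 ?subr_ge0// le_max lexx.
    by rewrite -lerBlDl opprB addrC subrK le_max lexx orbT.
  exists (Num.max L 1) => [|s t]; first by rewrite lt_max ltr01 orbT.
  by apply: (le_trans (hL _ _)); rewrite ler_wpM2r// le_max lexx.
move=> t; apply/cvgrPdist_le => e e0.
near=> s; apply: (le_trans (hK _ _)).
rewrite -ler_pdivlMl//.
near: s; apply: cvgr_dist_le; first exact: cvg_id.
by rewrite mulr_gt0 ?invr_gt0.
Unshelve. all: by end_near. Qed.

Lemma continuous_coord (k : 'I_d) : continuous (fun x : Q => \val x ord0 k).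
Proof.
move=> x; apply: (@continuous_comp Q 'rV[R]_d R (@set_val _ (@cube R d))
  (fun v : 'rV[R]_d => v ord0 k)); last exact: coord_continuous.
exact: initial_continuous.
Qed.

Lemma affine_continuous (m p q off : nat) (y : 'rV[R]_m) (g : Q -> 'rV[R]_p) :
  (forall j, continuous (fun x => g x ord0 j)) ->
  forall i, continuous (fun x => affine y off q (g x) ord0 i).
Proof.
move=> cg i.
pose a j := param y (off + i * (p + 1) + j).
pose b := param y (off + i * (p + 1) + p).
have -> : (fun x => affine y off q (g x) ord0 i) =
    (fun x => \sum_(j < p) g x ord0 j * a j + b).
  apply/funext => x; rewrite !mxE; congr (_ + _).
  by apply: eq_bigr => j _; rewrite mxE.
exact: (@continuous_wsum R Q p a b (fun j x => g x ord0 j)).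
Qed.

Lemma hidden_continuous (m : nat) (sigma : R -> R) (y : 'rV[R]_m) :
  continuous sigma ->
  forall l j, continuous (fun x : Q => hidden W sigma y l (\val x) ord0 j).
Proof.
move=> cs.
have step (h : Q -> 'rV[R]_W) (j : 'I_W) :
    continuous (fun x => h x ord0 j) ->
    continuous (fun x => map_mx sigma (h x) ord0 j).
  move=> ch; have -> : (fun x => map_mx sigma (h x) ord0 j) =
      (fun x => sigma (h x ord0 j)) by apply/funext => x; rewrite mxE.
  exact: (@continuous_post R Q _ _ ch cs).
elim=> [|l IH] j; apply: step; apply: affine_continuous => // k.
exact: continuous_coord.
Qed.

Lemma network_continuous (n : nat) (L : R) (sigma : R -> R)
    (hsigma : activation L sigma) (y : 'rV[R]_(nparams d W n)) :
  (fun x : Q => network sigma y (\val x)) \in @cube_cont R d.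
Proof.
apply/mem_set; apply: affine_continuous.
exact: (hidden_continuous (activation_continuous hsigma)).
Qed.

End network_continuity.

Definition Phi (R : realType) (d W n : nat) (L : R) (sigma : R -> R)
    (hsigma : activation L sigma) (y : 'rV[R]_(nparams d W n)) : cubeC R d :=
  CubeC (network_continuous hsigma y).

(* Main.v *)
(* With w >= 1 bounding the parameters, P = d + W, a = (P + 1) w and
   K = max(1, L), an affine map multiplies the size of a vector of size >= 1 by
   at most a, so layer l takes values of size at most a^(l+1). Perturbing the
   parameters by delta adds an error of at most a^(l+1) delta per affine map to
   a times the error already present; hence by induction the error after layer
   l is at most (2 K a)^(l+1) delta, and (2 K a)^(n+1) delta for the network.
   As n + 1 <= 2n, this has the form (C w)^(2n), which is bounded by a power of
   2 of exponent 2 log2(C) n (1 + log2 w); that power serves as Ln. *)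
Require Import Defs.
From mathcomp Require Import all_boot all_order all_algebra.
From mathcomp Require Import all_classical all_reals all_analysis.
From mathcomp Require Import ring lra.
Import Order.TTheory GRing.Theory Num.Theory.
Import numFieldNormedType.Exports.
Local Open Scope ring_scope.

(** * Size and perturbation of one affine map *)

Lemma normr_coord_le {R : realType} {m : nat} (y : 'rV[R]_m) (j : 'I_m) :
  `|y ord0 j| <= `|y|.
Proof.
rewrite {2}/Num.norm /= mx_normrE.
exact: (@le_bigmax _ _ _ 0 (fun ij : 'I_1 * 'I_m => `|y ij.1 ij.2|) (ord0, j)).
Qed.

Lemma normr_param_le {R : realType} {m : nat} (y : 'rV[R]_m) (k : nat) :
  `|param y k| <= `|y|.
Proof.
(* An index out of range reads the default 0, so the bound holds for every [k] and the layout of [y]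
   never enters the estimates. *)
rewrite /param; case: insub => [j|] /=; first exact: normr_coord_le.
by rewrite normr0.
Qed.

Lemma paramB {R : realType} {m : nat} (y y' : 'rV[R]_m) (k : nat) :
  param (y - y') k = param y k - param y' k.
Proof. by rewrite /param; case: insub => [j|] /=; rewrite ?mxE ?subr0. Qed.

Lemma affineE {R : realType} {m p q : nat} (y : 'rV[R]_m) (off : nat)
    (x : 'rV[R]_p) (i : 'I_q) :
  affine y off q x ord0 i =
    \sum_j x ord0 j * param y (off + i * (p + 1) + j)
      + param y (off + i * (p + 1) + p).
Proof.
by rewrite !mxE; congr (_ + _); apply: eq_bigr => j _; rewrite mxE.
Qed.

(** The bias counts as one more term of size [M]. Weakening [p] to [P] lets the input layer
    ([p = d]) and the later ones ([p = W]) share one constant. *)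
Lemma normr_sum_add_le {R : realType} {p P : nat} (F : 'I_p -> R) (b M : R) :
  (p <= P)%N -> (forall j, `|F j| <= M) -> `|b| <= M ->
  `|\sum_j F j + b| <= P.+1%:R * M.
Proof.
move=> pP FM bM; have M0 : 0 <= M by apply: le_trans bM.
apply: (@le_trans _ _ (p.+1%:R * M)); last by rewrite ler_wpM2r// ler_nat.
rewrite -natr1 mulrDl mul1r; apply: (le_trans (ler_normD _ _)).
apply: lerD => //; apply: (le_trans (ler_norm_sum _ _ _)).
apply: (@le_trans _ _ (\sum_(j < p) M)); first exact: ler_sum.
by rewrite sumr_const card_ord mulr_natl.
Qed.

Lemma normr_affine_le {R : realType} {m p P q : nat} (y : 'rV[R]_m)
    (off : nat) (x : 'rV[R]_p) (i : 'I_q) (w B : R) :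
  (p <= P)%N -> `|y| <= w -> 1 <= B -> (forall j, `|x ord0 j| <= B) ->
  `|affine y off q x ord0 i| <= P.+1%:R * w * B.
Proof.
move=> pP yw B1 xB; have yk k := le_trans (normr_param_le y k) yw.
have w0 := le_trans (normr_ge0 y) yw.
rewrite affineE -mulrA; apply: normr_sum_add_le => // [j|].
  by rewrite normrM mulrC ler_pM.
(* The bias is not multiplied by an input; [1 <= B] absorbs it into [w * B]. *)
by apply: (le_trans (yk _)); rewrite ler_peMr.
Qed.

Lemma affine_dist_le {R : realType} {m p P q : nat} (y y' : 'rV[R]_m)
    (off : nat) (x x' : 'rV[R]_p) (i : 'I_q) (w B D : R) :
  (p <= P)%N -> `|y| <= w -> 1 <= B -> 0 <= D ->
  (forall j, `|x' ord0 j| <= B) ->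
  (forall j, `|x ord0 j - x' ord0 j| <= D) ->
  `|affine y off q x ord0 i - affine y' off q x' ord0 i|
    <= P.+1%:R * (w * D + `|y - y'| * B).
Proof.
move=> pP yw B1 D0 xB xD; have yk k := le_trans (normr_param_le y k) yw.
have dk k : `|param y k - param y' k| <= `|y - y'|.
  by rewrite -paramB normr_param_le.
have w0 := le_trans (normr_ge0 y) yw.
rewrite !affineE opprD addrACA -sumrB; apply: normr_sum_add_le => // [j|].
  set a := param y _; set a' := param y' _.
  (* This splitting separates the error inherited from the input from the error in the parameter, so
     only the size of [a] and of [x'] is used. *)
  have -> : x ord0 j * a - x' ord0 j * a' =
      a * (x ord0 j - x' ord0 j) + (a - a') * x' ord0 j by ring.
  apply: (le_trans (ler_normD _ _)); rewrite !normrM.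
  by apply: lerD; apply: ler_pM => //; [exact: yk|exact: dk].
apply: (le_trans (dk _)).
by apply: (@le_trans _ _ (`|y - y'| * B)); rewrite ?ler_peMr// lerDr mulr_ge0.
Qed.

(** * Bounds common to both kinds of activation *)

Lemma activation_normr_le {R : realType} {L : R} {sigma : R -> R} :
  activation L sigma -> forall t, `|sigma t| <= Num.max 1 `|t|.
Proof.
case=> [[-> _]|[s1 _]] t; last by rewrite le_max s1.
rewrite le_max; apply/orP; right.
by rewrite /relu ger0_norm ?le_max ?lexx// ge_max normr_ge0 ler_norm.
Qed.

(** The maximum with 1 keeps the factor at least 1 even for small [L], so that powers of [2 * K * a]
    dominate powers of [a]. *)
Lemma activation_lipschitz {R : realType} {L : R} {sigma : R -> R} :
  activation L sigma ->
  forall t t', `|sigma t - sigma t'| <= Num.max 1 L * `|t - t'|.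
Proof.
case=> [[-> ->]|[_ sL]] t t'; last first.
  by apply: (le_trans (sL t t')); rewrite ler_wpM2r// le_max lexx orbT.
rewrite maxxx mul1r /relu.
have := ler_norm (t' - t); rewrite distrC; have := ler_norm (t - t').
by case: (leP 0 t); case: (leP 0 t') => ? ? ? ?; rewrite ler_norml;
  apply/andP; split; lra.
Qed.

(** * Growth of values and errors through the layers *)

Section hidden_layers.
Context {R : realType} {d W m : nat} {L w : R} {sigma : R -> R}.
Hypotheses (hsigma : activation L sigma) (w1 : 1 <= w).
Local Notation a := ((d + W).+1%:R * w).
Local Notation K := (Num.max 1 L).

Let a1 : 1 <= a.
Proof. by rewrite mulr_ege1 ?ler1n. Qed.

Let K1 : 1 <= K. Proof. by rewrite le_max lexx. Qed.

Lemma normr_hidden_le (y : 'rV[R]_m) (x : 'rV[R]_d) (l : nat) (j : 'I_W) :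
  `|y| <= w -> (forall k, `|x ord0 k| <= 1) ->
  `|hidden W sigma y l x ord0 j| <= a ^+ l.+1.
Proof.
move=> yw x1; elim: l j => [|l IH] j; rewrite mxE;
    apply: (le_trans (activation_normr_le hsigma _)); rewrite ge_max;
    rewrite exprn_ege1//=.
  by rewrite -[a in _ <= a]mulr1; apply: normr_affine_le; rewrite ?leq_addr.
by rewrite exprS; apply: normr_affine_le; rewrite ?leq_addl ?exprn_ege1.
Qed.

(** One step before activation, for input, hidden and output layers alike; the factor [K] missing
    from the next power comes from the activation. *)
Lemma affine_dist_step (y y' : 'rV[R]_m) (p q off l : nat) (x x' : 'rV[R]_p)
    (i : 'I_q) :
  (p <= d + W)%N -> `|y| <= w ->
  (forall j, `|x' ord0 j| <= a ^+ l) ->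
  (forall j, `|x ord0 j - x' ord0 j| <= (2 * K * a) ^+ l * `|y - y'|) ->
  `|affine y off q x ord0 i - affine y' off q x' ord0 i|
    <= 2 * a * (2 * K * a) ^+ l * `|y - y'|.
Proof.
move=> pP yw xB xD.
have KK : 1 <= 2 * K.
  by rewrite (le_trans K1)// ler_peMl ?ler1n// (le_trans ler01).
have KKa : a <= 2 * K * a by rewrite ler_peMl// (le_trans ler01).
have a0 : 0 <= a by exact: le_trans ler01 a1.
have b0 : 0 <= 2 * K * a by exact: le_trans KKa.
apply: (le_trans (affine_dist_le y y' off x x' i w _ _ pP yw _ _ xB xD)).
- by rewrite exprn_ege1.
- by rewrite mulr_ge0 ?exprn_ge0.
(* The factor 2 pays for both errors: the inherited one is the first summand, and the new one, at
   most [a ^+ l] times the parameter distance, is below the second since [1 <= w]. *)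
have -> : 2 * a * (2 * K * a) ^+ l * `|y - y'| =
    (d + W).+1%:R * (w * ((2 * K * a) ^+ l * `|y - y'|)
       + w * ((2 * K * a) ^+ l * `|y - y'|)) by ring.
rewrite ler_wpM2l// lerD2l [leLHS]mulrC mulrA ler_wpM2r//.
apply: (@le_trans _ _ ((2 * K * a) ^+ l)); last by rewrite ler_peMl ?exprn_ge0.
by rewrite lerXn2r.
Qed.

Lemma hidden_dist_le (y y' : 'rV[R]_m) (x : 'rV[R]_d) (l : nat) (j : 'I_W) :
  `|y| <= w -> `|y'| <= w -> (forall k, `|x ord0 k| <= 1) ->
  `|hidden W sigma y l x ord0 j - hidden W sigma y' l x ord0 j|
    <= (2 * K * a) ^+ l.+1 * `|y - y'|.
Proof.
move=> yw yw' x1; have K0 : 0 <= K by exact: le_trans ler01 K1.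
have step (t t' : R) k : `|t - t'| <= 2 * a * (2 * K * a) ^+ k * `|y - y'| ->
    `|sigma t - sigma t'| <= (2 * K * a) ^+ k.+1 * `|y - y'|.
  move=> tt'; apply: (le_trans (activation_lipschitz hsigma t t')).
  have -> : (2 * K * a) ^+ k.+1 * `|y - y'| =
      K * (2 * a * (2 * K * a) ^+ k * `|y - y'|) by rewrite exprS; ring.
  by rewrite ler_wpM2l.
elim: l j => [|l IH] j; rewrite mxE [map_mx _ _ _ _]mxE; apply: step.
  (* Both networks receive the same [x], so the inherited error is zero at [l = 0]. *)
  apply: affine_dist_step; rewrite ?leq_addr// => k; rewrite expr0 ?x1//.
  by rewrite subrr normr0 mul1r.
apply: affine_dist_step => // [|k]; first exact: leq_addl.
exact: normr_hidden_le.
Qed.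

End hidden_layers.

(** * The whole network and its Lipschitz constant *)

Lemma Phi_dist_le {R : realType} {d W n : nat} {L w : R} {sigma : R -> R}
    (hsigma : activation L sigma) (y y' : 'rV[R]_(nparams d W n)) :
  (0 < n)%N -> 1 <= w -> `|y| <= w -> `|y'| <= w ->
  `|Phi hsigma y - Phi hsigma y'|
    <= (2 * Num.max 1 L * ((d + W).+1%:R * w)) ^+ n.+1 * `|y - y'|.
Proof.
move=> n0 w1 yw yw'; apply: cubeC_norm_le => x.
have x1 k : `|\val x ord0 k| <= 1.
  have /andP[x0 x1] : 0 <= \val x ord0 k <= 1 by exact: (set_mem (valP x)).
  by rewrite ger0_norm.
have nE : n = (n - 1).+1 by rewrite subn1 prednK.
have := @affine_dist_step _ d W _ L w w1 y y' W 1 (offset d W n) n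
  (hidden W sigma y (n - 1) (\val x)) (hidden W sigma y' (n - 1) (\val x))
  ord0 (leq_addl _ _) yw.
have K1 : 1 <= Num.max 1 L by rewrite le_max lexx.
move=> /(_ _ _)/le_trans; apply.
- by move=> j; rewrite [X in _ ^+ X]nE; exact: (normr_hidden_le hsigma).
- by move=> j; rewrite [X in _ ^+ X]nE; exact: (hidden_dist_le hsigma).
(* No activation follows the output map; its missing factor [K] is supplied by [1 <= K]. *)
rewrite exprS !ler_wpM2r ?exprn_ge0// ?mulr_ge0// ?(le_trans ler01)//.
by rewrite ler_peMr.
Qed.

(** After taking logarithms, the claim is that [ln w] may be multiplied by [ln C / ln 2], which is
    at least 1 because [2 <= C]. *)
Lemma expr_le_powR2 {R : realType} (C w : R) (n : nat) :
  2 <= C -> 1 <= w ->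
  (C * w) ^+ n <= 2 `^ (ln C / ln 2 * n%:R * (1 + ln w / ln 2)).
Proof.
move=> C2 w1; have C0 : 0 < C by apply: lt_le_trans C2.
have w0 : 0 < w by apply: lt_le_trans w1.
have ln20 : 0 < ln 2 :> R by rewrite ln_gt0// ltr1n.
have lnC : ln 2 <= ln C by rewrite ler_ln ?posrE.
have Cw0 : 0 < C * w by exact: mulr_gt0.
rewrite -powR_mulrn ?(ltW Cw0)// -ler_ln ?posrE ?powR_gt0//.
rewrite !ln_powR lnM ?posrE//.
have -> : ln C / ln 2 * n%:R * (1 + ln w / ln 2) * ln 2 =
    n%:R * (ln C + ln C / ln 2 * ln w) by field; exact: lt0r_neq0.
rewrite ler_wpM2l// lerD2l ler_peMl ?ln_ge0//.
by rewrite ler_pdivlMr// mul1r.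
Qed.

Theorem theorem3p1 (R : realType) (d W : nat) (hd : (1 <= d)%N)
    (hW : (2 <= W)%N) (L c0 : R) :
  exists c1 c2 : R, [/\ 0 < c1, 0 < c2 &
    forall (X : completeNormedModType R) (iota : {linear cubeC R d -> X})
        (iota_inj : injective iota)
        (iota_le : forall f : cubeC R d, `|iota f| <= c0 * `|f|)
        (sigma : R -> R) (hsigma : activation L sigma)
        (w : nat -> R)
        (hw : forall n, (1 <= n)%N -> 1 <= w n)
        (hLWw : forall n, (1 <= n)%N -> 2 <= L * W%:R * w n)
        (n : nat) (hn : (1 <= n)%N),
      exists Ln : R,
        (forall y y' : 'rV[R]_(nparams d W n), `|y| <= w n -> `|y'| <= w n ->
           `|iota (Phi hsigma y) - iota (Phi hsigma y')|
             <= c0 * `|Phi hsigma y - Phi hsigma y'| /\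
           c0 * `|Phi hsigma y - Phi hsigma y'| <= Ln * `|y - y'|) /\
        (2 `^ (c1 * n%:R * (1 + ln (w n) / ln 2)) < Ln /\
         Ln < 2 `^ (c2 * n%:R * (1 + ln (w n) / ln 2)))].
Proof.
pose K : R := 2 * Num.max 1 L * (d + W).+1%:R.
(* The factor [1 + |c0|] dominates [c0] whatever its sign and keeps [C] at least 2. *)
pose C : R := (1 + `|c0|) * K.
have K2 : 2 <= K.
  by rewrite /K -mulrA ler_peMr// mulr_ege1 ?ler1n// le_max lexx.
have c01 : 1 <= 1 + `|c0| by rewrite lerDl.
have C2 : 2 <= C by rewrite (le_trans K2)// ler_peMl// (le_trans _ K2).
have ln20 : 0 < ln 2 :> R by rewrite ln_gt0// ltr1n.
pose lam : R := ln C / ln 2.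
have lam0 : 0 < lam.
  by rewrite divr_gt0// ln_gt0// (lt_le_trans _ C2)// ltr1n.
(* [Ln] will have [2 * lam] in its exponent, strictly between these two. The lower bound thus
   concerns the chosen [Ln], not the smallest Lipschitz constant. *)
exists lam, (3 * lam); split; [by []|by rewrite mulr_gt0|].
move=> X iota _ iota_le sigma hsigma w hw _ n hn.
have w1 := hw n hn; have w0 : 0 <= w n by exact: le_trans w1.
have mono (a b : R) : a < b ->
    2 `^ (a * n%:R * (1 + ln (w n) / ln 2)) <
    2 `^ (b * n%:R * (1 + ln (w n) / ln 2)).
  move=> ab; rewrite -ltr_ln ?posrE ?powR_gt0// !ln_powR ltr_pM2r//.
  rewrite -!mulrA ltr_pM2r// mulr_gt0 ?ltr0n//.
  by rewrite ltr_pwDl// divr_ge0 ?ln_ge0 ?ler1n.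
exists (2 `^ (2 * lam * n%:R * (1 + ln (w n) / ln 2))).
split=> [y y' yw yw'|]; last first.
  split; first by apply: (mono lam); rewrite ltr_pMl ?ltr1n.
  by apply: (mono (2 * lam)); rewrite ltr_pM2r ?ltr_nat.
split; first by rewrite -linearB.
have Cw1 : 1 <= C * w n by rewrite mulr_ege1// (le_trans _ C2)// ler1n.
have -> : 2 * lam * n%:R = lam * (2 * n)%:R by rewrite natrM; ring.
apply: le_trans (ler_wpM2r (normr_ge0 _) (expr_le_powR2 C (w n) (2 * n) C2 w1)).
apply: le_trans (ler_wpM2r (normr_ge0 _) (_ : (C * w n) ^+ n.+1 <= _));
  last first.
  by rewrite ler_weXn2l// mul2n -addnn -addn1 leq_add2l.
have Kw0 : 0 <= K * w n by rewrite mulr_ge0// (le_trans _ K2).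
apply: (@le_trans _ _ ((1 + `|c0|) * ((K * w n) ^+ n.+1 * `|y - y'|))).
  apply: (@le_trans _ _ ((1 + `|c0|) * `|Phi hsigma y - Phi hsigma y'|)).
    by rewrite ler_wpM2r// (le_trans (ler_norm _))// lerDr.
  rewrite ler_wpM2l// ?(le_trans _ c01)//.
  by have := Phi_dist_le hsigma y y' hn w1 yw yw'; rewrite [X in X ^+ _]mulrA.
(* A single factor [1 + |c0|] is at most its power [n.+1], which is contained in that of [C]. *)
rewrite mulrA ler_wpM2r// /C -(mulrA _ K) [leRHS]exprMn ler_wpM2r ?exprn_ge0//.
by rewrite ler_eXnr.
Qed.
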